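(* Let $\square$ be a square (regarded as the set of its four vertices). There is a natural number $n_0$ such that for any integer $n\ge n_0$ and any positive integer $r$, we have $\mathbb{E}^n\overset{r}{\rightarrow}(\square;\square)_{\mathrm{GR}}$.
   Context: $\mathbb{E}^n$ denotes $n$-dimensional Euclidean space. An $r$-coloring of $\mathbb{E}^n$ is an assignment to each point of one of $r$ colors (not all colors need be used). A set of points is monochromatic if all its points have the same color, and rainbow if its points have pairwise distinct colors. $\mathbb{E}^n\overset{r}{\rightarrow}(K_1;K_2)_{\mathrm{GR}}$ means that every $r$-coloring of $\mathbb{E}^n$ contains either a monochromatic set congruent (isometric) to $K_1$ or a rainbow set congruent to $K_2$. *)

(* Defs.v *)
From mathcomp Require Import all_boot all_order all_algebra.
From mathcomp Require Import classical_sets functions reals.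

Set Implicit Arguments.
Unset Strict Implicit.
Unset Printing Implicit Defensive.

Import Order.TTheory GRing.Theory Num.Theory.

Local Open Scope classical_set_scope.
Local Open Scope ring_scope.

(* The library's norm on row vectors is the sup norm, hence these explicit
   Euclidean notions on E^n := 'rV[R]_n. *)
Definition edot (R : realType) (n : nat) (x y : 'rV[R]_n) : R :=
  \sum_(i < n) x ord0 i * y ord0 i.

Definition edist (R : realType) (n : nat) (x y : 'rV[R]_n) : R :=
  Num.sqrt (edot (x - y) (x - y)).

(* K and L may lie in Euclidean spaces of different dimensions. *)
Definition congruent (R : realType) (m n : nat)
    (K : set 'rV[R]_m) (L : set 'rV[R]_n) : Prop :=
  exists f : 'rV[R]_m -> 'rV[R]_n,
    set_bij K L f /\
    (forall x y, K x -> K y -> edist (f x) (f y) = edist x y).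

Definition coloring (R : realType) (r n : nat) : Type := 'rV[R]_n -> 'I_r.

Definition monochromatic (R : realType) (r n : nat)
    (c : coloring R r n) (L : set 'rV[R]_n) : Prop :=
  forall x y, L x -> L y -> c x = c y.

Definition rainbow (R : realType) (r n : nat)
    (c : coloring R r n) (L : set 'rV[R]_n) : Prop :=
  forall x y, L x -> L y -> x <> y -> c x <> c y.

(* E^n -r-> (K1; K2)_GR *)
Definition GR_arrow (R : realType) (n r m1 m2 : nat)
    (K1 : set 'rV[R]_m1) (K2 : set 'rV[R]_m2) : Prop :=
  forall c : coloring R r n,
    (exists L : set 'rV[R]_n, congruent K1 L /\ monochromatic c L) \/
    (exists L : set 'rV[R]_n, congruent K2 L /\ rainbow c L).

(* The vertex set of a nondegenerate square of arbitrary side length, position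
   and orientation in E^d. *)
Definition is_square (R : realType) (d : nat) (Q : set 'rV[R]_d) : Prop :=
  exists p u v : 'rV[R]_d,
    [/\ u != 0, edot u v = 0, edot u u = edot v v &
        Q = [set p; p + u; p + u + v; p + v]].

(* Main.v *)
Require Import Defs.
From mathcomp Require Import all_boot all_order all_algebra.
From mathcomp Require Import classical_sets functions reals.
From mathcomp Require Import boolp ring.

Set Implicit Arguments.
Unset Strict Implicit.
Unset Printing Implicit Defensive.

Import Order.TTheory GRing.Theory Num.Theory.

(** Only squares in a product of three regular simplices are needed. The points
    k (e_a + e_b + e_z), with (a, b, z) in A x B x Z and distinct basis vectors
    for distinct indices, have squared distance 2 k^2 times the number of indices
    in which they differ; so, for the right k, changing two of the three indices
    independently traces a square of the wanted side. It remains to find, in any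
    coloring of a large finite grid A x B x Z with arbitrarily many colors, an
    axis-parallel rectangle which is monochromatic or rainbow
    ([grid_gallai_square]). The size of the grid does not depend on the number
    of colors, hence neither does the dimension n0 = |A| + |B| + |Z|.

    Two dimensions do not suffice: the coloring of A x B by its first index has
    neither kind of rectangle. However, nothing worse happens in a plane: if A
    and B are large, there is a rainbow rectangle or a rectangle whose color
    depends on one index only ([plane_rectangle]). If no plane contains a rainbow
    rectangle and Z is large, four planes share the position and the kind of
    such a rectangle, say with sides a, a' and b, b' and a color independent of
    b. If no monochromatic rectangle exists, then the colors g z and h z of
    (a, b, z) and (a', b, z) differ for each of these z, and g and h are
    injective, since two levels with the same color at (a, b) would give a
    monochromatic rectangle in direction (B, Z). Two injections with g <> h
    everywhere on four points have two points where the four values are distinct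
    ([two_injections]), which gives a rainbow rectangle in direction (A, Z). *)

(** * Two finite counting arguments *)

Lemma large_fibre (T K : finType) (k : nat) (D : {set T}) (t : T -> K) :
  k * #|K| < #|D| -> exists y, k < #|[set x in D | t x == y]|.
Proof.
move=> ltkD; apply/existsP; apply: contraLR ltkD; rewrite negb_exists -leqNgt.
move=> /forallP small.
rewrite -sum1_card (partition_big t xpredT) //= mulnC -sum_nat_const.
apply: leq_sum => y _; rewrite sum1_card leqNgt.
by have := small y; rewrite cardsE.
Qed.

(** Fix any x: injectivity leaves at most one y with h y = g x and at most one y
    with g y = h x; together with x itself this excludes at most three points. *)
Lemma two_injections (T : finType) (C : eqType) (S : {set T}) (g h : T -> C) :
    3 < #|S| -> {in S &, injective g} -> {in S &, injective h} ->
    {in S, forall x, g x != h x} ->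
  exists x y, [/\ x \in S, y \in S, x != y & uniq [:: g x; h x; g y; h y]].
Proof.
move=> S3 injg injh ngh.
have /card_gt0P[x xS] : 0 < #|S| by apply: leq_trans S3.
pose bad : {set T} :=
  [set x] :|: [set y in S | h y == g x] :|: [set y in S | g y == h x].
have bad3 : #|bad| <= 3.
  apply: leq_trans (leq_card_setU _ _) _; apply: (@leq_add _ _ 2 1).
    apply: leq_trans (leq_card_setU _ _) _.
    apply: (@leq_add _ _ 1 1); first by rewrite cards1.
    apply/card_le1_eqP => y z; rewrite !inE => /andP[yS /eqP hy].
    by move=> /andP[zS /eqP hz]; apply: injh; rewrite // hy hz.
  apply/card_le1_eqP => y z; rewrite !inE => /andP[yS /eqP hy].
  by move=> /andP[zS /eqP hz]; apply: injg; rewrite // hy hz.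
have /subsetPn[y yS] : ~~ (S \subset bad).
  by apply: contraL S3 => /subset_leq_card le; rewrite -leqNgt (leq_trans le).
rewrite !inE yS /= !negb_or => /andP[/andP[nyx nhg] ngh'].
exists x, y; split=> //; first by rewrite eq_sym.
rewrite /= !inE !negb_or ngh // [g x == h y]eq_sym nhg [h x == g y]eq_sym ngh'.
rewrite ngh // !andbT /=; apply/andP; split.
  by apply: contraNneq nyx => /injg ->.
by apply: contraNneq nyx => /injh ->.
Qed.

(** If more than |B|^2 rows repeat a color, two of them repeat it in the same two
    columns. Otherwise two rows are injective on B: they agree in two columns,
    or they differ in at least four and [two_injections] applies. The
    first two cases include the monochromatic rectangles. *)
Lemma plane_rectangle (A B : finType) (C : eqType) (f : A -> B -> C) :
    4 < #|B| -> (#|{: B * B}|).+1 < #|A| ->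
  exists a a' b b', [/\ a != a', b != b' &
    [\/ f a b = f a b' /\ f a' b = f a' b',
        f a b = f a' b /\ f a b' = f a' b'
      | uniq [:: f a b; f a' b; f a b'; f a' b']]].
Proof.
move=> B4 AB.
pose eqp a (p : B * B) := (p.1 != p.2) && (f a p.1 == f a p.2).
pose D : {set A} := [set a | [exists p, eqp a p]].
have [bD|] := ltnP #|{: B * B}| #|D|.
  have /card_gt0P[b0 _] : 0 < #|B| by apply: leq_trans B4.
  pose t a := odflt (b0, b0) [pick p | eqp a p].
  have tP a : a \in D -> eqp a (t a).
    rewrite inE /t => /existsP[p ep]; case: pickP => // /(_ p).
    by rewrite ep.
  have [|[b b'] /card_gt1P[a [a' []]]] := @large_fibre _ _ 1 D t.
    by rewrite mul1n.
  rewrite !inE => /andP[/existsP aD /eqP ta] /andP[/existsP a'D /eqP ta'] naa'.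
  have /andP[nb /eqP e1] : eqp a (b, b') by rewrite -ta tP // inE; apply/existsP.
  have /andP[_ /eqP e2] : eqp a' (b, b') by rewrite -ta' tP // inE; apply/existsP.
  by exists a, a', b, b'; split=> //; constructor 1.
move=> leD; have /card_gt1P[a [a' []]] : 1 < #|~: D|.
  by rewrite -(ltn_add2l #|D|) cardsC addn1 (leq_ltn_trans _ AB).
have injD x : x \in ~: D -> injective (f x).
  rewrite !inE => /existsPn nD b b' e; apply/eqP.
  by have := nD (b, b'); rewrite /eqp /= e eqxx andbT negbK.
move=> /injD inja /injD inja' naa'.
pose S : {set B} := [set b | f a b != f a' b].
have [/card_gt1P[b [b' []]]|cS] := ltnP 1 #|~: S|.
  rewrite !inE !negbK => /eqP e /eqP e' nb.
  by exists a, a', b, b'; split=> //; constructor 2.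
have [|||x|b [b' [_ _ nb u]]] := @two_injections _ _ S (f a) (f a').
- by move: B4; rewrite -(cardsC S) => B4; rewrite -(ltn_add2r 1)
     (leq_trans B4) // leq_add2l.
- by move=> x y _ _; apply: inja.
- by move=> x y _ _; apply: inja'.
- by rewrite inE.
by exists a, a', b, b'; split=> //; constructor 3.
Qed.

(** * Squares in a three-dimensional grid *)

Section Grid.
Variables (A B Z : finType) (C : eqType).

Definition hamming (x y : A * B * Z) : nat :=
  (x.1.1 != y.1.1) + (x.1.2 != y.1.2) + (x.2 != y.2).

(** The two booleans select a value for each of the two indices that vary, so
    that opposite vertices have complementary labels. Requiring only the Hamming
    distances treats the three directions of rectangles alike. *)
Definition unit_square (P : bool * bool -> A * B * Z) : Prop :=
  forall s t, hamming (P s) (P t) = (s.1 != t.1) + (s.2 != t.2).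

Definition gallai_square (f : A * B * Z -> C) : Prop :=
  exists P, unit_square P /\
    ((forall s t, f (P s) = f (P t)) \/ injective (fun s => f (P s))).

Lemma const_square (f : A * B * Z -> C) (P : bool * bool -> A * B * Z) (c : C) :
    unit_square P -> f (P (false, false)) = c -> f (P (false, true)) = c ->
    f (P (true, false)) = c -> f (P (true, true)) = c -> gallai_square f.
Proof.
by move=> uP ? ? ? ?; exists P; split=> //; left=> -[[] []] [[] []] //; congruence.
Qed.

Lemma rainbow_square (f : A * B * Z -> C) (P : bool * bool -> A * B * Z) :
    unit_square P ->
    uniq [:: f (P (false, false)); f (P (true, false));
             f (P (false, true)); f (P (true, true))] -> gallai_square f.
Proof.
move=> uP; rewrite /= !inE !negb_or => /and4P[/and3P[n1 n2 n3] /andP[n4 n5] n6 _].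
exists P; split=> //; right=> -[[] []] [[] []] //= e; exfalso.
all: by move: n1 n2 n3 n4 n5 n6; rewrite e eqxx.
Qed.

Definition square12 a a' b b' z (s : bool * bool) : A * B * Z :=
  (if s.1 then a' else a, if s.2 then b' else b, z).
Definition square13 a a' b z z' (s : bool * bool) : A * B * Z :=
  (if s.1 then a' else a, b, if s.2 then z' else z).
Definition square23 a b b' z z' (s : bool * bool) : A * B * Z :=
  (a, if s.1 then b' else b, if s.2 then z' else z).

Lemma unit_square12 a a' b b' z :
  a != a' -> b != b' -> unit_square (square12 a a' b b' z).
Proof.
move=> n1 n2 [[] []] [[] []]; rewrite /hamming /= ?eqxx //.
all: by rewrite ?[a' == a]eq_sym ?[b' == b]eq_sym ?n1 ?n2.
Qed.

Lemma unit_square13 a a' b z z' :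
  a != a' -> z != z' -> unit_square (square13 a a' b z z').
Proof.
move=> n1 n2 [[] []] [[] []]; rewrite /hamming /= ?eqxx //.
all: by rewrite ?[a' == a]eq_sym ?[z' == z]eq_sym ?n1 ?n2.
Qed.

Lemma unit_square23 a b b' z z' :
  b != b' -> z != z' -> unit_square (square23 a b b' z z').
Proof.
move=> n1 n2 [[] []] [[] []]; rewrite /hamming /= ?eqxx //.
all: by rewrite ?[b' == b]eq_sym ?[z' == z]eq_sym ?n1 ?n2.
Qed.

(** The case where the levels in S carry the same rectangle, colored by its first
    index: a coincidence of colors at one level or between two levels gives a
    monochromatic square, and otherwise the columns over (a, b) and (a', b) are
    as [two_injections] requires. *)
Lemma stacked_rectangles (f : A * B * Z -> C) (a a' : A) (b b' : B)
    (S : {set Z}) :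
    a != a' -> b != b' -> 3 < #|S| ->
    {in S, forall z, f (a, b, z) = f (a, b', z)} ->
    {in S, forall z, f (a', b, z) = f (a', b', z)} ->
  gallai_square f.
Proof.
move=> na nb S3 ea ea'.
have [/exists_inP[z zS /eqP e]|/exists_inPn neq] :=
    boolP [exists z in S, f (a, b, z) == f (a', b, z)].
  apply: (const_square (c := f (a, b, z)) (unit_square12 z na nb)) => //.
  - by rewrite /square12 /= ea.
  - by rewrite /square12 /= -ea'.
(* A repeated color over (x, b) is a monochromatic square, because (x, b') has
   the same colors as (x, b) at all levels in S. *)
have col x : {in S, forall z, f (x, b, z) = f (x, b', z)} ->
    gallai_square f \/ {in S &, injective (fun z => f (x, b, z))}.
  move=> ex; have [inj|] := boolP [forall z in S, forall z' in S,
      (f (x, b, z) == f (x, b, z')) ==> (z == z')].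
    right=> z z' zS z'S e; apply/eqP.
    by move/forall_inP/(_ z zS)/forall_inP/(_ z' z'S)/implyP: inj; apply; apply/eqP.
  move/forall_inPn=> [z zS /forall_inPn[z' z'S]].
  rewrite negb_imply => /andP[/eqP e nz]; left.
  apply: (const_square (c := f (x, b, z)) (unit_square23 x nb nz)) => //.
  - by rewrite /square23 /= -ex.
  - by rewrite /square23 /= -ex // e.
have [//|inja] := col _ ea; have [//|inja'] := col _ ea'.
have [z [z' [zS z'S nz u]]] := two_injections S3 inja inja' neq.
exact: (rainbow_square (unit_square13 b na nz)).
Qed.

End Grid.

(** Reduces rectangles colored by their second index to [stacked_rectangles]. *)
Lemma gallai_square_transpose (A B Z : finType) (C : eqType)
    (f : A * B * Z -> C) :
  gallai_square (fun x : B * A * Z => f (x.1.2, x.1.1, x.2)) -> gallai_square f.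
Proof.
move=> [P [uP dP]]; exists (fun s => ((P s).1.2, (P s).1.1, (P s).2)).
split=> // s t; rewrite -(uP s t) /hamming /=.
by congr (_ + _); rewrite addnC.
Qed.

(** The bound on Z gives each pattern of [plane_rectangle] three levels, so that
    some pattern occurs in four. *)
Lemma grid_gallai_square (A B Z : finType) (C : eqType) (f : A * B * Z -> C) :
    4 < #|B| -> (#|{: B * B}|).+1 < #|A| ->
    3 * #|{: A * A * (B * B) * bool}| < #|Z| ->
  gallai_square f.
Proof.
move=> B4 AB AZ; have [//|noP] := pselect (gallai_square f).
(* The last component tells whether the color at level z is constant along the
   rows (A fixed) or along the columns (B fixed) of the rectangle. *)
pose Q z (q : A * A * (B * B) * bool) :=
  let: (a, a', (b, b'), rows) := q in
  [&& a != a', b != b' &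
   if rows then (f (a, b, z) == f (a, b', z)) && (f (a', b, z) == f (a', b', z))
   else (f (a, b, z) == f (a', b, z)) && (f (a, b', z) == f (a', b', z))].
have exQ z : exists q, Q z q.
  have [a [a' [b [b' [na nb]]]]] := plane_rectangle (fun a b => f (a, b, z)) B4 AB.
  case=> [[e e']|[e e']|u].
  - by exists (a, a', (b, b'), true); rewrite /Q na nb e e' !eqxx.
  - by exists (a, a', (b, b'), false); rewrite /Q na nb e e' !eqxx.
  - by case: noP; apply: (rainbow_square (unit_square12 z na nb)).
pose t z := xchoose (exQ z).
have tP z : Q z (t z) by apply: xchooseP.
have [|[[[a a'] [b b']] rows] S3] := @large_fibre _ _ 3 [set: Z] t.
  by rewrite cardsT.
set S := [set x in _ | _] in S3.
have SQ z : z \in S -> Q z (a, a', (b, b'), rows).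
  by rewrite !inE => /eqP <-.
have /card_gt0P[z0 /SQ /and3P[na nb _]] : 0 < #|S| by apply: leq_trans S3.
case: rows @S S3 SQ => S S3 SQ.
  by apply: (stacked_rectangles na nb S3) => z /SQ /and3P[_ _ /andP[/eqP e /eqP]].
apply: gallai_square_transpose.
by apply: (stacked_rectangles nb na S3) => z /SQ /and3P[_ _ /andP[/eqP e /eqP]].
Qed.

(** * The grid in Euclidean space *)

Section Euclid.
Local Open Scope classical_set_scope.
Local Open Scope ring_scope.
Variable R : realType.

Lemma edotC n (x y : 'rV[R]_n) : edot x y = edot y x.
Proof. by apply: eq_bigr => i _; rewrite mulrC. Qed.

Lemma edotDl n (x y z : 'rV[R]_n) : edot (x + y) z = edot x z + edot y z.
Proof. by rewrite -big_split; apply: eq_bigr => i _; rewrite mxE mulrDl. Qed.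

Lemma edotZl n a (x z : 'rV[R]_n) : edot (a *: x) z = a * edot x z.
Proof. by rewrite /edot mulr_sumr; apply: eq_bigr => i _; rewrite mxE mulrA. Qed.

Lemma edotDr n (x y z : 'rV[R]_n) : edot z (x + y) = edot z x + edot z y.
Proof. by rewrite edotC edotDl !(edotC z). Qed.

Lemma edotZr n a (x z : 'rV[R]_n) : edot z (a *: x) = a * edot z x.
Proof. by rewrite edotC edotZl (edotC z). Qed.

Lemma edotBB n (x y : 'rV[R]_n) :
  edot (x - y) (x - y) = edot x x + edot y y - 2 * edot x y.
Proof.
by rewrite -scaleN1r !(edotDl, edotDr, edotZl, edotZr) (edotC y x); ring.
Qed.

Lemma edot_ge0 n (x : 'rV[R]_n) : 0 <= edot x x.
Proof. by apply: sumr_ge0 => i _; rewrite -expr2 sqr_ge0. Qed.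

Lemma edot_eq0 n (x : 'rV[R]_n) : edot x x = 0 -> x = 0.
Proof.
move/eqP; rewrite psumr_eq0 => [/allP x0|i _]; last by rewrite -expr2 sqr_ge0.
apply/rowP => i; apply/eqP; have := x0 i (mem_index_enum _).
by rewrite mulf_eq0 orbb mxE.
Qed.

Lemma edist0 n (x : 'rV[R]_n) : edist x x = 0.
Proof.
by rewrite /edist subrr [edot _ _]big1 ?sqrtr0 // => i _; rewrite mxE mul0r.
Qed.

Lemma edist_eq0 n (x y : 'rV[R]_n) : edist x y = 0 -> x = y.
Proof.
move/eqP; rewrite sqrtr_eq0 => le0; apply/subr0_eq/edot_eq0/eqP.
by rewrite eq_le le0 edot_ge0.
Qed.

Lemma edot_delta n (i j : 'I_n) :
  edot (delta_mx 0 i : 'rV[R]_n) (delta_mx 0 j) = (i == j)%:R.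
Proof.
rewrite /edot (bigD1 i) //= big1 => [|k nk]; last first.
  by rewrite !mxE (negPf nk) /= mul0r.
by rewrite !mxE !eqxx addr0 mul1r.
Qed.

(** The map P i |-> P' i is well defined and injective because points at
    distance zero coincide; hence the parametrizations may repeat points. *)
Lemma congruent_range (I : pointedType) m n (P : I -> 'rV[R]_m)
    (P' : I -> 'rV[R]_n) :
    (forall i j, edist (P' i) (P' j) = edist (P i) (P j)) ->
  congruent (range P) (range P').
Proof.
move=> dP; pose f x := P' (get (fun i => P i = x)).
have fP i : f (P i) = P' i.
  apply: edist_eq0; rewrite dP.
  have -> : P (get (fun j => P j = P i)) = P i.
    by apply: (@getPex _ (fun j => P j = P i)); exists i.
  exact: edist0.
have isof x y : range P x -> range P y -> edist (f x) (f y) = edist x y.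
  by move=> [i _ <-] [j _ <-]; rewrite !fP dP.
exists f; split=> //; split.
- by move=> _ [i _ <-]; rewrite fP; exists i.
- move=> x y /set_mem Px /set_mem Py e.
  by apply: edist_eq0; rewrite -isof // e edist0.
- by move=> _ [i _ <-]; exists (P i); [exists i|rewrite fP].
Qed.

Lemma square_range d (p u v : 'rV[R]_d) :
  [set p; p + u; p + u + v; p + v] =
  range (fun s : bool * bool => p + s.1%:R *: u + s.2%:R *: v).
Proof.
apply/seteqP; split=> x /=.
  move=> [[[->|->]|->]|->];
    [exists (false, false)|exists (true, false)|exists (true, true)
    |exists (false, true)] => //=; by rewrite ?scale0r ?scale1r ?addr0.
move=> [[[] []] _ <-] /=; rewrite ?scale0r ?scale1r ?addr0; tauto.
Qed.

Lemma edist_square d (p u v : 'rV[R]_d) (s t : bool * bool) :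
    edot u v = 0 -> edot u u = edot v v ->
  edist (p + s.1%:R *: u + s.2%:R *: v) (p + t.1%:R *: u + t.2%:R *: v) =
  Num.sqrt (edot u u * ((s.1 != t.1) + (s.2 != t.2))%:R).
Proof.
move=> uv uu; rewrite /edist; congr Num.sqrt.
rewrite (_ : _ - _ = (s.1%:R - t.1%:R) *: u + (s.2%:R - t.2%:R) *: v); last first.
  by apply/rowP => i; rewrite !mxE; ring.
rewrite !(edotDl, edotDr, edotZl, edotZr) (edotC v u) uv -uu.
by case: s t => [[] []] [[] []] /=; ring.
Qed.

Section GridPoint.
Variables (A B Z : finType) (n : nat) (e : A + B + Z -> 'I_n).

Definition grid_point (k : R) (x : A * B * Z) : 'rV[R]_n :=
  k *: (delta_mx 0 (e (inl (inl x.1.1))) + delta_mx 0 (e (inl (inr x.1.2))) +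
        delta_mx 0 (e (inr x.2))).

Lemma edist_grid_point k (x y : A * B * Z) :
    injective e ->
  edist (grid_point k x) (grid_point k y) =
  Num.sqrt (2 * k ^+ 2 * (hamming x y)%:R).
Proof.
move=> inje; have dot u v : edot (grid_point k u) (grid_point k v) =
    k ^+ 2 * ((u.1.1 == v.1.1)%:R + (u.1.2 == v.1.2)%:R + (u.2 == v.2)%:R).
  rewrite /grid_point !(edotDl, edotDr, edotZl, edotZr) !edot_delta !(inj_eq inje).
  by rewrite !(inj_eq inl_inj, inj_eq inr_inj) /=; ring.
rewrite /edist edotBB !dot !eqxx /hamming; congr Num.sqrt.
by do 3![case: (_ == _) => /=]; ring.
Qed.

End GridPoint.

End Euclid.

Theorem theorem1p8 (R : realType) (d : nat) (Q : set 'rV[R]_d)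
    (hQ : is_square Q) :
  exists n0 : nat, forall n r : nat, (n0 <= n)%N -> (0 < r)%N ->
    GR_arrow n r Q Q.
Proof.
pose B : finType := 'I_5; pose A : finType := 'I_(#|{: B * B}|).+2.
pose Z : finType := 'I_(3 * #|{: A * A * (B * B) * bool}|).+1.
exists #|{: A + B + Z}| => n r len _ c.
have [p [u [v [_ uv uu ->]]]] := hQ.
pose e (x : A + B + Z) : 'I_n := widen_ord len (enum_rank x).
have inje : injective e.
  by move=> x y /(congr1 val) /= /val_inj /enum_rank_inj.
(* Grid neighbours differ by a vector of squared length 2 k^2, which has to be
   the squared side of Q. *)
pose k : R := Num.sqrt (edot u u / 2).
have k2 : (2 * k ^+ 2 = edot u u)%R.
  rewrite sqr_sqrtr; first by field.
  by rewrite divr_ge0 ?edot_ge0.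
have [P [uP dP]] : gallai_square (fun x : A * B * Z => c (grid_point e k x)).
  by apply: grid_gallai_square; rewrite !card_ord.
have cong : congruent (range (fun s : bool * bool => p + s.1%:R *: u + s.2%:R *: v)%R)
    (range (fun s => grid_point e k (P s))).
  apply: congruent_range => s t.
  by rewrite edist_grid_point // uP k2 edist_square.
rewrite square_range; case: dP => dP; [left|right]; eexists; split; first exact: cong.
- by move=> _ _ [s _ <-] [t _ <-]; apply: dP.
- exact: cong.
- by move=> _ _ [s _ <-] [t _ <-] nxy /dP est; apply: nxy; rewrite est.
Qed.
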